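(* There is an absolute constant $C>0$ such that for all integers $k\ge 2$ and all positive integers $n_1\ge n_2\ge\dots\ge n_k$, $$c^{\mathrm{EF}}(n_1,\dots,n_k)\ \ge\ C\sqrt{n_1}.$$
   Context: There is a finite set $G$ of items (goods) and $k$ groups of agents of sizes $n_1,\dots,n_k$. The $j$-th agent of group $i$ has a utility function $u^{(i,j)}$ on subsets of $G$ that is monotone and additive: $u^{(i,j)}(S)=\sum_{g\in S}u^{(i,j)}(g)$ for all $S\subseteq G$, with $u^{(i,j)}(g)\ge 0$ for all $g\in G$. An allocation $A=(A_1,\dots,A_k)$ is a partition of $G$ into $k$ (possibly empty) bundles, where $A_i$ is allocated to group $i$. For a nonnegative integer $c$, $A$ is envy-free up to $c$ goods (EF$c$) if for all $i,i'\in\{1,\dots,k\}$ and $j\in\{1,\dots,n_i\}$ there is a set $B\subseteq G$ with $|B|\le c$ such that $u^{(i,j)}(A_i)\ge u^{(i,j)}(A_{i'}\setminus B)$. $c^{\mathrm{EF}}(n_1,\dots,n_k)$ is the smallest $c$ such that, for every finite set $G$ of goods and every choice of monotone additive utilities of the agents, an EF$c$ allocation exists. *)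

(* Defs.v *)
From HB Require Import structures.
From mathcomp Require Import all_boot all_order all_algebra.
From mathcomp Require Import all_classical all_reals ereal.

Set Implicit Arguments.
Unset Strict Implicit.
Unset Printing Implicit Defensive.

Import Order.TTheory GRing.Theory Num.Theory.
Local Open Scope ring_scope.

Definition monotone_additive (R : realType) (G : finType)
    (u : {set G} -> R) : Prop :=
  (forall S : {set G}, u S = \sum_(g in S) u [set g]%SET) /\
  (forall g : G, 0 <= u [set g]%SET).

Definition is_allocation (G : finType) (k : nat) (A : 'I_k -> {set G}) : Prop :=
  (\bigcup_(i < k) A i)%SET = [set: G]%SET /\
  (forall i i' : 'I_k, i != i' -> [disjoint A i & A i']).

(* [u i j] is the utility function of the j-th agent of group i. *)
Definition envy_free_up_to (R : realType) (G : finType) (k : nat)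
    (n : 'I_k -> nat) (u : forall i : 'I_k, 'I_(n i) -> {set G} -> R)
    (c : nat) (A : 'I_k -> {set G}) : Prop :=
  forall (i i' : 'I_k) (j : 'I_(n i)),
    exists B : {set G}, (#|B| <= c)%N /\ u i j (A i' :\: B) <= u i j (A i).

Definition EF_guaranteed (R : realType) (k : nat) (n : 'I_k -> nat)
    (c : nat) : Prop :=
  forall (G : finType) (u : forall i : 'I_k, 'I_(n i) -> {set G} -> R),
    (forall (i : 'I_k) (j : 'I_(n i)), monotone_additive (u i j)) ->
    exists A : 'I_k -> {set G}, is_allocation A /\ envy_free_up_to u c A.

(* The infimum is taken in the extended reals, so that cEF needs no proof that
   some c is guaranteed; as c ranges over nat, it is a minimum whenever one is
   (see cEF_smallest), and otherwise it would be +oo. *)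
Definition cEF (R : realType) (k : nat) (n : 'I_k -> nat) : \bar R :=
  ereal_inf [set (c%:R)%:E | c in [set c : nat | EF_guaranteed R n c]]%classic.

Lemma cEF_smallest (R : realType) (k : nat) (n : 'I_k -> nat) (c : nat) :
  EF_guaranteed R n c ->
  (forall c' : nat, EF_guaranteed R n c' -> (c <= c')%N) ->
  cEF R n = (c%:R)%:E.
Proof.
move=> hc hmin; apply/eqP; rewrite eq_le; apply/andP; split.
  by apply: ereal_inf_lbound; exists c.
by apply: le_ereal_inf_tmp => _ [c' hc' <-]; rewrite lee_fin ler_nat; apply: hmin.
Qed.

(* Main.v *)
(* Let N = 2^a with 2N - 1 <= n_1 < 4N, and take an N x N Hadamard matrix H.
   The goods are q = floor(k/2) identical copies of each column of H.  In group 1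
   the agents have the supports of the positive and of the negative parts of the
   rows of H as binary valuations; everybody else values all goods equally.
   Envy-freeness up to c goods makes A_1 proportional up to c for every agent of
   group 1, whereas |A_1| <= |G|/k + c because of the other groups.  So if z_t is
   the number of copies of column t in A_1 and x_t = z_t - q/k, then every entry
   of H x is at most 3c in absolute value.  Since z_t is an integer and
   1/3 <= q/k <= 1/2, |x_t| >= 1/3, hence |H x|^2 = N |x|^2 >= N^2 / 9, which
   forces c >= sqrt N / 9 >= sqrt n_1 / 18. *)
Require Import Defs.
From mathcomp Require Import all_boot all_order all_algebra.
From mathcomp Require Import all_classical all_reals ereal.
From mathcomp Require Import zify ring lra.

Set Implicit Arguments.
Unset Strict Implicit.
Unset Printing Implicit Defensive.

Import Order.TTheory GRing.Theory Num.Theory.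
Local Open Scope ring_scope.

(** * Sylvester's Hadamard matrix and the orthogonality of its columns *)

Section SylvesterHadamard.

Variable a : nat.
Implicit Types h t : {ffun 'I_a -> bool}.

(** The inner product over the field with two elements: [(-1) ^+ dotb h t] is the entry of the
    matrix in row [h] and column [t]. *)
Definition dotb h t : bool := \big[addb/false]_(i < a) (h i && t i).

Lemma dot0b t : dotb [ffun=> false] t = false.
Proof. by rewrite /dotb big1 // => i _; rewrite ffunE. Qed.

Lemma sign_dotb (R : pzRingType) h t :
  (-1) ^+ dotb h t = \prod_(i < a) (-1) ^+ (h i && t i) :> R.
Proof.
by apply: (big_morph (fun b : bool => (-1) ^+ b : R) (@signr_addb R)).
Qed.

(** The sum over all [h] factors into one sum over a bit for each coordinate. A coordinate where [t]
    and [t'] agree contributes 2, one where they differ contributes 1 - 1 = 0. *)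
Lemma sum_sign_dotb (R : comPzRingType) t t' :
  \sum_h (-1) ^+ dotb h t * (-1) ^+ dotb h t' = (2 ^ a)%:R *+ (t == t') :> R.
Proof.
under eq_bigr => h _ do rewrite !sign_dotb -big_split /=.
rewrite -(bigA_distr_bigA (fun i b =>
  (-1) ^+ (b && t i) * (-1) ^+ (b && t' i) : R)) /=.
under eq_bigr => i _ do rewrite big_bool /= mul1r.
have [<-|/eqP neq_tt'] := eqVneq t t'.
  under eq_bigr => i _ do rewrite -signr_addb addbb expr0 -mulr2n.
  by rewrite prodr_const card_ord natrX.
have [i neq_i] : exists i, t i != t' i.
  apply/existsP; rewrite -negb_forall; apply/negP => /forallP eq_tt'.
  by apply: neq_tt'; apply/ffunP => i; apply/eqP.
rewrite (bigD1 i) //= -signr_addb.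
have -> : t i (+) t' i = true by case: (t i) (t' i) neq_i => [] [].
by rewrite expr1 addNr mul0r.
Qed.

Lemma parseval_dotb (R : comPzRingType) (x : {ffun 'I_a -> bool} -> R) :
  \sum_h (\sum_t (-1) ^+ dotb h t * x t) ^+ 2 =
  (2 ^ a)%:R * \sum_t x t ^+ 2.
Proof.
transitivity (\sum_t \sum_t' x t * x t' *
    \sum_h (-1) ^+ dotb h t * (-1) ^+ dotb h t').
  under eq_bigr => h _ do rewrite expr2 big_distrlr /=.
  rewrite exchange_big; apply: eq_bigr => t _ /=.
  rewrite exchange_big; apply: eq_bigr => t' _ /=.
  by rewrite big_distrr; apply: eq_bigr => h _ /=; ring.
rewrite big_distrr; apply: eq_bigr => t _ /=.
rewrite (bigD1 t) //= [X in _ + X]big1 ?addr0 => [|t' neq_t't].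
  by rewrite sum_sign_dotb eqxx mulrC -expr2.
by rewrite sum_sign_dotb eq_sym (negPf neq_t't) mulr0.
Qed.

End SylvesterHadamard.

(** * Binary utilities, and the deviation of a bundle from the proportional share *)

Lemma card_setI_sum (G : finType) (S W : {set G}) :
  #|S :&: W| = (\sum_(g in S) (g \in W))%N.
Proof.
rewrite -sum1_card [LHS](eq_bigl (fun g => (g \in S) && (g \in W))).
  by rewrite big_mkcondr; apply: eq_bigr => g _; case: (g \in W).
by move=> g; rewrite inE.
Qed.

Definition binary_utility (R : realType) (G : finType) (W S : {set G}) : R :=
  #|S :&: W|%:R.

Lemma binary_utility_additive (R : realType) (G : finType) (W : {set G}) :
  monotone_additive (@binary_utility R G W).
Proof.
split=> [S|g]; last exact: ler0n.
rewrite /binary_utility card_setI_sum natr_sum; apply: eq_bigr => g _.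
by rewrite card_setI_sum big_set1.
Qed.

(** Every good is worth at most 1, so removing [B] lowers the value by at most [c]. *)
Lemma binary_utility_up_to (R : realType) (G : finType) (W S S' : {set G}) c :
  (exists B : {set G}, (#|B| <= c)%N /\
     binary_utility R W (S' :\: B) <= binary_utility R W S) ->
  (#|S' :&: W| <= #|S :&: W| + c)%N.
Proof.
move=> [B [leBc]]; rewrite ler_nat => leSW.
apply: leq_trans (leq_add leSW leBc); rewrite (leq_trans _ (leq_card_setU _ _)) //.
apply/subset_leq_card/fintype.subsetP => g; rewrite !inE.
by case: (g \in B); case: (g \in W); case: (g \in S').
Qed.

Lemma sum_card_allocation (G : finType) k (A : 'I_k -> {set G}) (W : {set G}) :
  is_allocation A -> (\sum_(i < k) #|A i :&: W|)%N = #|W|.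
Proof.
move=> [covA disA]; under eq_bigr => i _ do rewrite finset.setIC card_setI_sum.
rewrite -[RHS]sum1_card exchange_big; apply: eq_bigr => g _ /=.
have /bigcupP[i _ gAi] : g \in (\bigcup_(i < k) A i)%SET by rewrite covA inE.
rewrite (bigD1 i) //= gAi big1 // => i' neq_i'i.
by have /disjointFl -> := disA i' i neq_i'i.
Qed.

Section Excess.

Variables (R : realType) (G : finType) (k : nat) (A : 'I_k -> {set G}).
Variables (i0 : 'I_k) (c : nat).
Hypothesis allocA : is_allocation A.

(** Density of a signed measure comparing [A i0] with an exact share 1/k of every good. Its sum over
    the copies of column t is the number x_t of the overview. *)
Definition excess (g : G) : R := (g \in A i0)%:R - k%:R^-1.

Lemma sum_excess (W : {set G}) :
  \sum_(g in W) excess g = #|A i0 :&: W|%:R - #|W|%:R / k%:R.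
Proof.
rewrite big_split /= sumrN sumr_const mulr_natl; congr (_ - _).
by rewrite finset.setIC card_setI_sum natr_sum.
Qed.

Let k_gt0 : 0 < k%:R :> R.
Proof. by rewrite ltr0n (leq_ltn_trans _ (ltn_ord i0)). Qed.

Lemma excess_ge (W : {set G}) :
  (forall i, #|A i :&: W| <= #|A i0 :&: W| + c)%N ->
  - c%:R <= \sum_(g in W) excess g.
Proof.
move=> envyW; rewrite sum_excess lerBrDr addrC lerBlDr ler_pdivrMr //.
rewrite -natrD -natrM ler_nat -(sum_card_allocation W allocA).
apply: leq_trans (leq_sum _ (fun i _ => envyW i)) _.
by rewrite sum_nat_const card_ord mulnC addnC.
Qed.

Lemma excess_le (W : {set G}) :
  (forall i, #|A i0 :&: W| <= #|A i :&: W| + c)%N ->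
  \sum_(g in W) excess g <= c%:R.
Proof.
move=> envyW; rewrite sum_excess lerBlDr -lerBlDl ler_pdivlMr //.
rewrite mulrBl lerBlDr -!natrM -natrD ler_nat -(sum_card_allocation W allocA).
have := leq_sum (index_enum 'I_k) (fun i (_ : xpredT i) => envyW i).
by rewrite big_split /= !sum_nat_const card_ord mulnC (mulnC k c).
Qed.

End Excess.

(** * The Hadamard instance and what envy-freeness says about it *)

Section HadamardInstance.

Variables (a q : nat).

Definition goods : finType := ({ffun 'I_a -> bool} * 'I_q)%type.

Definition half (p : {ffun 'I_a -> bool} * bool) : {set goods} :=
  [set g | dotb p.1 g.1 == p.2].

(* The only pair whose half is empty; leaving it out saves one agent, which
   matters when there is a single agent in every group. *)
Definition void_pair : {ffun 'I_a -> bool} * bool := ([ffun=> false], true).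

Lemma half_void : half void_pair = finset.set0.
Proof. by apply/setP => g; rewrite !inE dot0b. Qed.

(** Agents beyond the end of the list fall back on [void_pair], hence on the zero utility. *)
Definition pair_of_agent (j : nat) : {ffun 'I_a -> bool} * bool :=
  nth void_pair (enum (predC1 void_pair)) j.

Lemma pair_of_agent_surj n p :
  (2 ^ a.+1 <= n.+1)%N -> p != void_pair -> exists j : 'I_n, pair_of_agent j = p.
Proof.
move=> le_n neq_p.
have p_in : p \in enum (predC1 void_pair) by rewrite mem_enum.
have lt_n : (index p (enum (predC1 void_pair)) < n)%N.
  apply: leq_trans (_ : _ <= #|predC1 void_pair|)%N _.
    by rewrite cardE index_mem.
  (* There are 2^(a+1) - 1 pairs other than [void_pair], which is why the hypothesis bounds
     [n.+1]. *)
  rewrite cardC1 card_prod card_ffun card_bool card_ord.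
  by move: le_n; rewrite expnSr; case: (_ * 2)%N.
by exists (Ordinal lt_n); rewrite /pair_of_agent /= nth_index.
Qed.

Definition hadamard_utility (R : realType) k (i0 : 'I_k) (i : 'I_k) (j : nat) :
    {set goods} -> R :=
  binary_utility R (if i == i0 then half (pair_of_agent j) else [set: goods]%SET).

Lemma half_excess_ge (R : realType) k (n : 'I_k -> nat) (i0 : 'I_k) c A p :
  (2 ^ a.+1 <= (n i0).+1)%N -> is_allocation A ->
  envy_free_up_to (fun i (j : 'I_(n i)) => hadamard_utility R i0 i j) c A ->
  - c%:R <= \sum_(g in half p) excess R A i0 g.
Proof.
move=> le_n allocA EFA; have [->|neq_p] := eqVneq p void_pair.
  by rewrite half_void big_set0 oppr_le0 ler0n.
have [j <-] := pair_of_agent_surj le_n neq_p.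
apply: excess_ge => // i; apply: (@binary_utility_up_to R).
by have := EFA i0 i j; rewrite /hadamard_utility eqxx.
Qed.

Lemma all_excess_le (R : realType) k (n : 'I_k -> nat) (i0 : 'I_k) c A :
  (forall i, 0 < n i)%N -> is_allocation A ->
  envy_free_up_to (fun i (j : 'I_(n i)) => hadamard_utility R i0 i j) c A ->
  \sum_g excess R A i0 g <= c%:R.
Proof.
move=> n_gt0 allocA EFA.
rewrite (eq_bigl [in [set: goods]%SET]); last by move=> g; rewrite inE.
apply: excess_le => // i; have [->|neq_i] := eqVneq i i0; first exact: leq_addr.
apply: (@binary_utility_up_to R).
by have := EFA i i0 (Ordinal (n_gt0 i)); rewrite /hadamard_utility (negPf neq_i).
Qed.

Lemma signed_excess (R : realType) k (A : 'I_k -> {set goods}) i0 h :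
  \sum_t (-1) ^+ dotb h t * \sum_(j < q) excess R A i0 (t, j) =
  \sum_(g in half (h, false)) excess R A i0 g -
  \sum_(g in half (h, true)) excess R A i0 g.
Proof.
under eq_bigr => t _ do rewrite big_distrr /=.
rewrite pair_big /=.
rewrite (bigID (fun g : goods => dotb h g.1)) /= addrC; congr (_ + _).
  apply: eq_big => [[t j]|[t j] /= /negPf ->]; last by rewrite expr0 mul1r.
  by rewrite inE /= eqbF_neg.
rewrite -sumrN; apply: eq_big => [[t j]|[t j] /= ->]; last by rewrite expr1 mulN1r.
by rewrite inE /= eqb_id.
Qed.

End HadamardInstance.

(** * Integrality against orthogonality: the bound on [c] *)

Lemma third_le_abs_sub_half (R : realType) (k z : nat) :
  (2 <= k)%N -> 1 / 9 <= (z%:R - k./2%:R / k%:R : R) ^+ 2.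
Proof.
move=> k_ge2; set r : R := k./2%:R / k%:R.
have k_gt0 : 0 < k%:R :> R by rewrite ltr0n ltnW.
(* The extreme case is [k] = 3, where r = 1/3. *)
have r_ge : 1 / 3 <= r.
  rewrite /r ler_pdivlMr // mulrAC mul1r ler_pdivrMr //.
  by rewrite -natrM ler_nat; lia.
have r_le : r <= 1 / 2.
  rewrite /r ler_pdivrMr // mulrAC mul1r ler_pdivlMr //.
  by rewrite -natrM ler_nat; lia.
case: z => [|z]; first by rewrite sub0r; nra.
have x_ge : 1 / 3 <= z.+1%:R - r by have := ler0n R z; rewrite -[z.+1%:R]natr1; lra.
by rewrite expr2; nra.
Qed.

Lemma EF_guaranteed_ge (R : realType) k (n : 'I_k -> nat) (i0 : 'I_k) c :
  (2 <= k)%N -> (forall i, 0 < n i)%N -> EF_guaranteed R n c ->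
  Num.sqrt (n i0)%:R <= 18 * c%:R :> R.
Proof.
move=> k_ge2 n_gt0 guar_c.
(* With N = 2^a this choice means 2N <= n_1 + 1 < 4N; the predecessor is harmless since n_1 >= 1
   makes the logarithm positive. *)
pose a := (trunc_log 2 (n i0).+1).-1; pose q := k./2.
have log_gt0 : (0 < trunc_log 2 (n i0).+1)%N by rewrite trunc_log_gt0 /= ltnS n_gt0.
have [le_n lt_n] : (2 ^ a.+1 <= (n i0).+1)%N /\ (n i0 <= 4 * 2 ^ a)%N.
  have /andP[] := @trunc_log_bounds 2 (n i0).+1 isT isT.
  rewrite -[trunc_log _ _]prednK // -/a => -> lt_n; split=> //.
  by move: lt_n; rewrite !expnS; lia.
have [|A [allocA EFA]] := guar_c (goods a q)
    (fun i (j : 'I_(n i)) => hadamard_utility R i0 i j).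
  by move=> i j; apply: binary_utility_additive.
pose x t : R := \sum_(j < q) excess R A i0 (t, j).
have x_ge t : 1 / 9 <= x t ^+ 2.
  have -> : x t = (\sum_(j < q) ((t, j) \in A i0))%:R - q%:R / k%:R.
    by rewrite /x big_split /= sumrN sumr_const card_ord mulr_natl natr_sum.
  exact: third_le_abs_sub_half.
(* The two halves of row [h] have excesses at least -c with sum at most c. Each is therefore at most
   2c, and their difference is at most 3c in absolute value. *)
have Hx_le h : (\sum_t (-1) ^+ dotb h t * x t) ^+ 2 <= 9 * c%:R ^+ 2.
  rewrite signed_excess.
  have D0 := half_excess_ge (h, false) le_n allocA EFA.
  have D1 := half_excess_ge (h, true) le_n allocA EFA.
  have := all_excess_le n_gt0 allocA EFA.
  rewrite (bigID [in half q (h, true)]) /= addrC.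
  rewrite [X in X + _](eq_bigl [in half q (h, false)]); last first.
    by move=> g; rewrite !inE /= eqb_id eqbF_neg.
  move: D0 D1; set d0 := \sum_(_ in half q (h, false)) _.
  by set d1 := \sum_(_ in half q (h, true)) _; nra.
have card_T : #|{ffun 'I_a -> bool}| = (2 ^ a)%N.
  by rewrite card_ffun card_bool card_ord.
have N_gt0 : 0 < (2 ^ a)%:R :> R by rewrite ltr0n expn_gt0.
have le_N : (2 ^ a)%:R <= 81 * c%:R ^+ 2 :> R.
  have sum_ge : (2 ^ a)%:R * (1 / 9) <= \sum_t x t ^+ 2.
    by rewrite -card_T mulr_natl -sumr_const; apply: ler_sum.
  (* The bound on a single row is summed over all 2^a rows and compared with Parseval's identity. *)
  have sum_le : (2 ^ a)%:R * \sum_t x t ^+ 2 <= (2 ^ a)%:R * (9 * c%:R ^+ 2).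
    rewrite -parseval_dotb -[in leRHS]card_T mulr_natl -sumr_const.
    by apply: ler_sum.
  by move: sum_le; rewrite ler_pM2l //; lra.
have c_ge0 : 0 <= c%:R :> R by exact: ler0n.
rewrite -[leRHS]ger0_norm; last by rewrite mulr_ge0.
rewrite -sqrtr_sqr ler_sqrt; last by rewrite sqr_ge0.
(* The constant 18 arises from n_1 <= 4N <= 4 * 81 c^2 = (18 c)^2. *)
have : (n i0)%:R <= 4 * (2 ^ a)%:R :> R by rewrite -natrM ler_nat.
by nra.
Qed.

Theorem corollary4p2 (R : realType) :
  exists C : R, 0 < C /\
    forall (k : nat) (hk : (2 <= k)%N) (n : 'I_k -> nat),
      (forall i : 'I_k, (0 < n i)%N) ->
      (forall i i' : 'I_k, (i <= i')%N -> (n i' <= n i)%N) ->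
      ((C * Num.sqrt (n (Ordinal (ltnW hk)))%:R)%:E <= cEF R n)%E.
Proof.
exists (1 / 18); split=> [|k hk n n_gt0 _]; first by lra.
apply: le_ereal_inf_tmp => _ [c guar_c <-]; rewrite lee_fin.
by have := EF_guaranteed_ge (Ordinal (ltnW hk)) hk n_gt0 guar_c; lra.
Qed.
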